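(* Let $\Omega\subset\mathbb{R}^n$ be a compact set, and suppose there is $\rho_1>0$ such that $\|f_p(x)-f_p(y)\|\le\rho_1\|x-y\|$ for all $x,y\in\Omega$ and all $p\in\mathcal{M}$. For a precision $\varepsilon>0$, denote by $\underline{Y}^{\varepsilon}$ the output of the inner-approximation algorithm (described in the context) run on $\Omega$ with precision $\varepsilon$. Then the algorithm terminates in a finite number of steps. Furthermore, if $\rho_1\varepsilon\le r$, then: (i) if $\underline{Y}^{\varepsilon}=\varnothing$, then the switched system does not have a nonempty $r$-robustly controlled invariant set contained in $\Omega$; (ii) if $\underline{Y}^{\varepsilon}\ne\varnothing$, then $\underline{Y}^{\varepsilon}$ is controlled invariant and $\mathcal{I}^{\infty}_r(\Omega)\subset\underline{Y}^{\varepsilon}\subset\mathcal{I}^{\infty}(\Omega)$.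
   Context: Switched system: $x_{k+1}=f_{p_k}(x_k)$, $k\in\mathbb{Z}_{\ge0}$, with state $x_k\in\mathbb{R}^n$, mode $p_k\in\mathcal{M}$, $\mathcal{M}$ a finite nonempty set, and each $f_p:\mathbb{R}^n\to\mathbb{R}^n$ continuous. A switching signal is an infinite sequence $\{p_k\}_{k\ge0}$ in $\mathcal{M}$. A set $A\subset\mathbb{R}^n$ is controlled invariant if for every $x_0\in A$ there is a switching signal whose resulting solution satisfies $x_k\in A$ for all $k\ge0$. $\mathcal{I}^{\infty}(\Omega)$ denotes the maximal controlled invariant set inside $\Omega$: the controlled invariant subset of $\Omega$ that contains all controlled invariant subsets of $\Omega$. $\|\cdot\|$ is the infinity norm; $\mathcal{B}_s:=\{y\in\mathbb{R}^n:\|y\|\le s\}$; $A\ominus B:=\{c\in\mathbb{R}^n: c+b\in A\ \forall b\in B\}$. $\mathrm{Pre}(A):=\{x\in\mathbb{R}^n:\exists p\in\mathcal{M},\ f_p(x)\in A\}$. For $r\ge0$, a compact set $A$ is $r$-robustly controlled invariant if $A\subset\mathrm{Pre}(A\ominus\mathcal{B}_r)$. $\mathcal{I}^{\infty}_r(\Omega)$ denotes the maximal $r$-robustly controlled invariant set inside $\Omega$: the $r$-robustly controlled invariant subset of $\Omega$ containing every $r$-robustly controlled invariant subset of $\Omega$. A box (interval) is $[x]=[\underline{x}_1,\overline{x}_1]\times\cdots\times[\underline{x}_n,\overline{x}_n]$, with width $w([x])=\max_i(\overline{x}_i-\underline{x}_i)$; $\mathbb{IR}^n$ is the set of boxes.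 For each $p$, $[f_p]:\mathbb{IR}^n\to\mathbb{IR}^n$ is a fixed convergent inclusion function of $f_p$: $f_p([x])\subset[f_p]([x])$ for all $[x]\in\mathbb{IR}^n$, and $\lim_{w([x])\to0}w([f_p]([x]))=0$. It is chosen so that $w([f_p]([x]))\le\rho_1 w([x])$ for all boxes $[x]\subset\Omega$. Procedure CPre$(Y,L,\varepsilon)$: the input is a target set $Y$, a finite list $L$ of boxes and $\varepsilon>0$. Start with $\underline{X},\Delta X,X_c$ empty. While $L$ is nonempty, remove a box $[x]$ from $L$ and do the following. - If $[f_p]([x])\cap Y=\varnothing$ for all $p\in\mathcal{M}$, put $[x]$ in $X_c$. - Otherwise, if $[f_p]([x])\subset Y$ for some $p\in\mathcal{M}$, put $[x]$ in $\underline{X}$. - Otherwise, if $w([x])<\varepsilon$, put $[x]$ in $\Delta X$. - Otherwise, bisect $[x]$ at the midpoint of a coordinate in which its width is attained, and add the two halves to $L$. The output is $(\underline{X},\Delta X,X_c)$. Inner-approximation algorithm: $\Omega$ is assumed to be a finite union of boxes. Initialize $L$ as a finite list of boxes (with pairwise disjoint interiors) whose union is $\Omega$, $\widetilde{Y}:=\Omega$, $Y:=\varnothing$. While $Y\ne\widetilde{Y}$: set $Y:=\widetilde{Y}$; compute $(\underline{X},\Delta X,X_c)=$ CPre$(Y,L,\varepsilon)$; set $\widetilde{Y}:=\bigcup_{[x]\in\underline{X}}[x]$ and $L:=\underline{X}$. Output $Y$. *)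

(* Defs.v *)
From Stdlib Require Export Relation_Operators.
From mathcomp Require Export all_boot all_order all_algebra.
From mathcomp Require Export all_classical all_reals all_analysis.
Import Order.TTheory GRing.Theory Num.Theory.
Import numFieldNormedType.Exports.

Set Implicit Arguments.
Unset Strict Implicit.
Unset Printing Implicit Defensive.

Local Open Scope classical_set_scope.
Local Open Scope ring_scope.

(* On 'rV[R]_n the norm `|x| is the largest absolute value of an entry, i.e.
   the infinity norm. *)

Section SwitchedSystem.
Variables (R : realType) (n : nat) (M : finType).
Variable f : M -> 'rV[R]_n -> 'rV[R]_n.

Fixpoint solution (p : nat -> M) (x0 : 'rV[R]_n) (k : nat) : 'rV[R]_n :=
  if k is k'.+1 then f (p k') (solution p x0 k') else x0.

Definition controlled_invariant (A : set 'rV[R]_n) : Prop :=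
  forall x0, A x0 -> exists p : nat -> M, forall k, A (solution p x0 k).

Definition Pre (A : set 'rV[R]_n) : set 'rV[R]_n :=
  [set x | exists p : M, A (f p x)].

Definition inf_ball (s : R) : set 'rV[R]_n := [set y | `|y| <= s].

Definition pontryagin_diff (A B : set 'rV[R]_n) : set 'rV[R]_n :=
  [set c | forall b, B b -> A (c + b)].

Definition robustly_controlled_invariant (r : R) (A : set 'rV[R]_n) : Prop :=
  compact A /\ A `<=` Pre (pontryagin_diff A (inf_ball r)).

(* I is the largest subset of Omega with property P; unique when it exists. *)
Definition maximal_inside (P : set 'rV[R]_n -> Prop)
    (Omega I : set 'rV[R]_n) : Prop :=
  [/\ P I, I `<=` Omega & forall A, P A -> A `<=` Omega -> A `<=` I].

End SwitchedSystem.

(* Boxes are nonempty; degenerate sides are allowed. *)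
Record box (R : realType) (n : nat) := Box {
  lo : 'rV[R]_n;
  hi : 'rV[R]_n;
  box_le : forall i, lo 0 i <= hi 0 i }.

Section Boxes.
Variables (R : realType) (n : nat).
Implicit Types (b : box R n) (L : seq (box R n)).

Definition box_set b : set 'rV[R]_n :=
  [set x | forall i, lo b 0 i <= x 0 i <= hi b 0 i].

Definition width b : R := \big[Num.max/0]_(i < n) (hi b 0 i - lo b 0 i).

Definition boxes_union L : set 'rV[R]_n :=
  \big[setU/set0]_(b <- L) box_set b.

Definition disjoint_interiors L : Prop :=
  trivIset [set: 'I_(size L)]
    (fun i => interior (box_set (tnth (in_tuple L) i))).

Definition mid b (i : 'I_n) : R := (lo b 0 i + hi b 0 i) / 2.

Lemma lo_le_mid b i : lo b 0 i <= mid b i.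
Proof. by rewrite /mid ler_pdivlMr// mulr_natr mulr2n lerD2l box_le. Qed.

Lemma mid_le_hi b i : mid b i <= hi b 0 i.
Proof. by rewrite /mid ler_pdivrMr// mulr_natr mulr2n lerD2r box_le. Qed.

Definition lower_hi b (i : 'I_n) : 'rV[R]_n :=
  \row_j (if j == i then mid b i else hi b 0 j).

Definition upper_lo b (i : 'I_n) : 'rV[R]_n :=
  \row_j (if j == i then mid b i else lo b 0 j).

Lemma lower_half_le b i j : lo b 0 j <= lower_hi b i 0 j.
Proof.
by rewrite mxE; case: eqP => [->|_]; [exact: lo_le_mid | exact: box_le].
Qed.

Lemma upper_half_le b i j : upper_lo b i 0 j <= hi b 0 j.
Proof.
by rewrite mxE; case: eqP => [->|_]; [exact: mid_le_hi | exact: box_le].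
Qed.

Definition lower_half b i : box R n := Box (@lower_half_le b i).
Definition upper_half b i : box R n := Box (@upper_half_le b i).

Definition inclusion_function (g : 'rV[R]_n -> 'rV[R]_n)
    (G : box R n -> box R n) : Prop :=
  forall b, g @` box_set b `<=` box_set (G b).

(* The limit is uniform over the boxes inside each fixed box K.  Uniformity
   over all boxes of the space would force g to be uniformly continuous,
   excluding e.g. g x = x ^+ 2. *)
Definition convergent (G : box R n -> box R n) : Prop :=
  forall (K : box R n) (eta : R), 0 < eta ->
    exists2 delta : R, 0 < delta &
      forall b, box_set b `<=` box_set K ->
        width b < delta -> width (G b) < eta.

End Boxes.

Section Algorithm.
Variables (R : realType) (n : nat) (M : finType).
Variables (F : M -> box R n -> box R n) (eps : R).

(* The fields are L, \underline X, \Delta X and X_c. *)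
Record cpre_state := CPreState {
  todo : seq (box R n);
  inner : seq (box R n);
  boundary : seq (box R n);
  outside : seq (box R n) }.

Definition misses (Y : set 'rV[R]_n) (b : box R n) : Prop :=
  forall p, box_set (F p b) `&` Y = set0.

Definition maps_into (Y : set 'rV[R]_n) (b : box R n) : Prop :=
  exists p, box_set (F p b) `<=` Y.

(* Nondeterministic: any box of the list may be removed, and any coordinate
   attaining the width may be bisected. *)
Inductive cpre_step (Y : set 'rV[R]_n) : cpre_state -> cpre_state -> Prop :=
| CPreOutside L1 b L2 Xi Xd Xc :
    misses Y b ->
    cpre_step Y (CPreState (L1 ++ b :: L2) Xi Xd Xc)
                (CPreState (L1 ++ L2) Xi Xd (b :: Xc))
| CPreInner L1 b L2 Xi Xd Xc :
    ~ misses Y b -> maps_into Y b ->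
    cpre_step Y (CPreState (L1 ++ b :: L2) Xi Xd Xc)
                (CPreState (L1 ++ L2) (b :: Xi) Xd Xc)
| CPreBoundary L1 b L2 Xi Xd Xc :
    ~ misses Y b -> ~ maps_into Y b -> width b < eps ->
    cpre_step Y (CPreState (L1 ++ b :: L2) Xi Xd Xc)
                (CPreState (L1 ++ L2) Xi (b :: Xd) Xc)
| CPreBisect L1 b L2 Xi Xd Xc i :
    ~ misses Y b -> ~ maps_into Y b -> eps <= width b ->
    hi b 0 i - lo b 0 i = width b ->
    cpre_step Y (CPreState (L1 ++ b :: L2) Xi Xd Xc)
      (CPreState (lower_half b i :: upper_half b i :: L1 ++ L2) Xi Xd Xc).

(* Test Y Yt L : about to evaluate the loop condition Y != Yt;
   Loop Y s    : inside CPre(Y, L, eps), in state s;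
   Done Y      : halted with output Y. *)
Inductive config :=
| Test of set 'rV[R]_n & set 'rV[R]_n & seq (box R n)
| Loop of set 'rV[R]_n & cpre_state
| Done of set 'rV[R]_n.

Inductive alg_step : config -> config -> Prop :=
| AlgExit Y Yt L : Y = Yt -> alg_step (Test Y Yt L) (Done Y)
| AlgEnter Y Yt L : Y <> Yt ->
    alg_step (Test Y Yt L) (Loop Yt (CPreState L [::] [::] [::]))
| AlgCPre Y s s' : cpre_step Y s s' -> alg_step (Loop Y s) (Loop Y s')
| AlgReturn Y Xi Xd Xc :
    alg_step (Loop Y (CPreState [::] Xi Xd Xc)) (Test Y (boxes_union Xi) Xi).

Definition alg_init (Omega : set 'rV[R]_n) (L0 : seq (box R n)) : config :=
  Test set0 Omega L0.

(* Every run from c is finite, and none gets stuck before reaching Done. *)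
Inductive terminates : config -> Prop :=
| TerminatesDone Y : terminates (Done Y)
| TerminatesStep c :
    (exists c', alg_step c c') ->
    (forall c', alg_step c c' -> terminates c') -> terminates c.

Definition alg_output (Omega : set 'rV[R]_n) (L0 : seq (box R n))
    (Y : set 'rV[R]_n) : Prop :=
  clos_refl_trans config alg_step (alg_init Omega L0) (Done Y).

End Algorithm.

(* Main.v *)
Require Import Defs.
From mathcomp Require Import zify lra.
Import Order.TTheory GRing.Theory Num.Theory.
Import numFieldNormedType.Exports.

Set Implicit Arguments.
Unset Strict Implicit.
Unset Printing Implicit Defensive.

Local Open Scope classical_set_scope.
Local Open Scope ring_scope.

(** Termination. Give a box the weight 3 ^ d, where d is the sum over the
    coordinates of the integer part of side length / eps. Bisecting a side of
    length at least eps lowers d by at least one, so the two halves together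
    weigh at most 2/3 of the box. Hence every step of CPre lowers the weight of
    the boxes still to be processed, and each call of CPre is finite
    ([cpre_step_todo]). Across calls, the weight of the boxes to be processed
    together with the inner ones never grows, and it stays constant only if
    every box of the list is kept unbisected ([cpre_step_potential]). In that
    case the union of the boxes has not changed and the loop test succeeds; so
    the outer loop follows a strictly decreasing sequence of natural numbers
    ([test_terminates]).

    Correctness. Let A be the largest r-robustly controlled invariant subset of
    Omega; it exists because the closure of the union of all such sets is again
    one ([maximal_robustly_controlled_invariant]). No point of A is ever
    discarded while A lies in the current target Y: at x in A some mode sends x
    to a point whose r-ball is contained in A, hence in Y. A box b
    containing x therefore does not miss Y, and if its width is below eps, then
    the enclosure of its image has width at most rho1 * eps <= r, so it lies in
    that r-ball, and b is inner ([robust_hits], [robust_maps_into]). Thus A is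
    contained in the output Y. On the other side, every box of the output was
    found to be mapped into the last target, which at exit equals Y; so
    Y is contained in Pre Y, which makes it controlled invariant
    ([pre_controlled_invariant]). *)

(** * Maximal invariant sets *)

Lemma maximal_controlled_invariant (R : realType) (n : nat) (M : finType)
    (f : M -> 'rV[R]_n -> 'rV[R]_n) (Omega : set 'rV[R]_n) :
  maximal_inside (controlled_invariant f) Omega
    (\bigcup_(A in [set A | controlled_invariant f A /\ A `<=` Omega]) A).
Proof.
split.
- move=> x [A [Ainv AO] Ax]; have [p Ap] := Ainv x Ax.
  by exists p => k; exists A.
- by move=> x [A [_ AO] /AO].
- by move=> A Ainv AO x Ax; exists A.
Qed.

(** A mode chosen as a function of the state keeps the orbit in [A]; read along
    that orbit, the feedback becomes a switching signal. *)
Lemma pre_controlled_invariant (R : realType) (n : nat) (M : finType)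
    (f : M -> 'rV[R]_n -> 'rV[R]_n) (A : set 'rV[R]_n) :
  A `<=` Pre f A -> controlled_invariant f A.
Proof.
move=> APre x0 Ax0; have [p0 _] := APre _ Ax0.
have /choice[g gP] : forall x, exists p, A x -> A (f p x).
  move=> x; have [Ax|nAx] := pselect (A x); last by exists p0.
  by have [p Ap] := APre _ Ax; exists p.
pose orbit k := iter k (fun x => f (g x) x) x0.
have sol k : solution f (fun k => g (orbit k)) x0 k = orbit k.
  by elim: k => //= k ->.
exists (fun k => g (orbit k)) => k; rewrite sol.
by elim: k => //= k; exact: gP.
Qed.

(** The set is an intersection, over the disturbances [b] in [B], of the
    preimages of [C] under the continuous maps [g x + b]. *)
Lemma closed_robust_preimage (R : realType) (n : nat)
    (g : 'rV[R]_n -> 'rV[R]_n) (C B : set 'rV[R]_n) :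
  continuous g -> closed C -> closed (g @^-1` pontryagin_diff C B).
Proof.
move=> cg clC.
have -> : g @^-1` pontryagin_diff C B =
    \bigcap_(b in B) (fun x => g x + b) @^-1` C by [].
apply: closed_bigI => b _; apply: preimage_closed => // x _.
by apply: continuousD; [exact: cg | exact: cst_continuous].
Qed.

(** Robust invariance includes compactness, which an infinite union can lose;
    the witness is therefore the closure of the union of all robust subsets.
    It is still robust, because there are finitely many modes: the states from
    which some mode enters the closure robustly form a finite union of closed
    sets, which contains the union, hence also its closure. *)
Lemma maximal_robustly_controlled_invariant (R : realType) (n : nat)
    (M : finType) (f : M -> 'rV[R]_n -> 'rV[R]_n) (Omega : set 'rV[R]_n)
    (r : R) :
  (forall p, continuous (f p)) -> compact Omega ->
  exists I, maximal_inside (robustly_controlled_invariant f r) Omega I.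
Proof.
move=> cf cO; pose isrob := robustly_controlled_invariant f r.
pose U := \bigcup_(A in [set A | isrob A /\ A `<=` Omega]) A.
have clO : closed Omega := compact_closed (@norm_hausdorff _ _) cO.
have clUO : closure U `<=` Omega.
  by rewrite [X in _ `<=` X](iffLR (closure_id _) clO);
    apply: closureS => x [A [_ AO] /AO].
exists (closure U); split => //; last first.
  by move=> A Arob AO x Ax; apply: subset_closure; exists A.
split; first exact: subclosed_compact (@closed_closure _ _) cO clUO.
pose C p := f p @^-1` pontryagin_diff (closure U) (inf_ball r).
have clC : closed (\bigcup_(p in [set: M]) C p).
  apply: closed_bigcup => [|p _]; first exact: finite_finset.
  exact: closed_robust_preimage (cf p) (@closed_closure _ _).
have UC : U `<=` \bigcup_(p in [set: M]) C p.
  move=> x [A [[cA APre] AO] Ax]; have [p Ap] := APre x Ax.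
  exists p => // b br; apply: subset_closure; exists A => //; exact: Ap.
move=> x /(closureS UC); rewrite -(iffLR (closure_id _) clC) => -[p _ Cpx].
by exists p.
Qed.

(** * Boxes *)

Section Boxes.
Context {R : realType} {n : nat}.
Implicit Types (b : box R n) (L : seq (box R n)).

Lemma boxes_union_nil : boxes_union [::] = set0 :> set 'rV[R]_n.
Proof. by rewrite /boxes_union big_nil. Qed.

Lemma boxes_union_cons b L : boxes_union (b :: L) = box_set b `|` boxes_union L.
Proof. by rewrite /boxes_union big_cons. Qed.

Lemma boxes_union_remove L1 b L2 :
  boxes_union (L1 ++ b :: L2) = box_set b `|` boxes_union (L1 ++ L2).
Proof. by rewrite /boxes_union !big_cat big_cons /= setUCA. Qed.

Lemma side_le_width b (i : 'I_n) : hi b 0 i - lo b 0 i <= width b.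
Proof. exact: le_bigmax. Qed.

(** Positivity matters in dimension 0, where the width is the default 0 of the
    maximum and there is no side. *)
Lemma width_attained b :
  0 < width b -> exists i : 'I_n, hi b 0 i - lo b 0 i = width b.
Proof.
move=> w0; have := lexx (width b); rewrite {2}/width => /bigmax_geP[|[i _ wi]].
  by rewrite leNgt w0.
by exists i; apply/le_anti; rewrite side_le_width.
Qed.

Lemma box_diameter b x y : box_set b x -> box_set b y -> `|y - x| <= width b.
Proof.
move=> bx by_; rewrite [leLHS]mx_normrE; apply: bigmax_le.
  exact: bigmax_ge_id.
move=> [i j] _ /=; rewrite (ord1 i) !mxE.
apply: le_trans (side_le_width b j); rewrite ler_norml.
by have /andP[? ?] := bx j; have /andP[? ?] := by_ j; apply/andP; split; lra.
Qed.

Lemma box_set_halves b i :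
  box_set b = box_set (lower_half b i) `|` box_set (upper_half b i).
Proof.
have [lm mh] := (lo_le_mid b i, mid_le_hi b i).
apply/seteqP; split=> [x bx|x [] bx j].
- have [xm|/ltW mx] := leP (x 0 i) (mid b i); [left|right] => j;
    have /andP[] := bx j; rewrite /= mxE; case: eqP => [->|_] lx xh;
    exact/andP.
- have /andP[] := bx j; rewrite /= mxE; case: eqP => [->|_] lx xh; apply/andP;
    split=> //; exact: le_trans xh mh.
- have /andP[] := bx j; rewrite /= mxE; case: eqP => [->|_] lx xh; apply/andP;
    split=> //; exact: le_trans lm lx.
Qed.

End Boxes.

(** * Termination *)

Section Potential.
Context {R : realType} {n : nat}.
Variable eps : R.
Hypothesis eps_gt0 : 0 < eps.
Implicit Types (b : box R n) (L : seq (box R n)).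

Definition side_depth b (i : 'I_n) : nat :=
  Num.truncn ((hi b 0 i - lo b 0 i) / eps).

(** Base 3 rather than 2, so that the two halves of a bisected box weigh strictly
    less than the box. *)
Definition weight b : nat := (3 ^ \sum_i side_depth b i)%N.

Definition total_weight L : nat := (\sum_(b <- L) weight b)%N.

Lemma weight_gt0 b : (0 < weight b)%N.
Proof. by rewrite expn_gt0. Qed.

(** If k <= x < k + 1 with k >= 1, then x / 2 < (k + 1) / 2 <= k. *)
Lemma truncn_half (x : R) : 1 <= x -> (Num.truncn (x / 2) < Num.truncn x)%N.
Proof.
move=> x1; have x0 : 0 <= x by lra.
rewrite truncn_lt_nat; last by lra.
have /andP[_] := truncn_itv x0; have := x1; rewrite -truncn_gt0.
case: (Num.truncn x) => // k _ xk.
by rewrite ltr_pdivrMr // (lt_le_trans xk) // -natrM ler_nat; lia.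
Qed.

Lemma weight_halve_side b b' i :
  eps <= hi b 0 i - lo b 0 i ->
  hi b' 0 i - lo b' 0 i = (hi b 0 i - lo b 0 i) / 2 ->
  (forall j, j != i -> hi b' 0 j - lo b' 0 j = hi b 0 j - lo b 0 j) ->
  (3 * weight b' <= weight b)%N.
Proof.
move=> bi b'i b'j; rewrite -expnS leq_exp2l // (bigD1 i) //=.
rewrite [X in (_ <= X)%N](bigD1 i) //=.
rewrite -addSn (eq_bigr (side_depth b)) ?leq_add2r; last first.
  by move=> j ji; rewrite /side_depth b'j.
by rewrite /side_depth b'i mulrAC truncn_half // ler_pdivlMr ?mul1r.
Qed.

Lemma weight_bisect b i :
  eps <= width b -> hi b 0 i - lo b 0 i = width b ->
  (weight (lower_half b i) + weight (upper_half b i) < weight b)%N.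
Proof.
move=> epsw bi; rewrite -bi in epsw.
have lowerw : (3 * weight (lower_half b i) <= weight b)%N.
  apply: (@weight_halve_side _ _ i) => //= [|j ji]; rewrite mxE ?eqxx ?(negPf ji) //.
  by rewrite /mid; lra.
have upperw : (3 * weight (upper_half b i) <= weight b)%N.
  apply: (@weight_halve_side _ _ i) => //= [|j ji]; rewrite mxE ?eqxx ?(negPf ji) //.
  by rewrite /mid; lra.
have := weight_gt0 b; lia.
Qed.

Lemma total_weight_cons b L : total_weight (b :: L) = (weight b + total_weight L)%N.
Proof. by rewrite /total_weight big_cons. Qed.

Lemma total_weight_remove L1 b L2 :
  total_weight (L1 ++ b :: L2) = (weight b + total_weight (L1 ++ L2))%N.
Proof. by rewrite /total_weight !big_cat big_cons /= addnCA. Qed.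

End Potential.

Section Run.
Context {R : realType} {n : nat} {M : finType}.
Variables (F : M -> box R n -> box R n) (eps : R).
Hypothesis eps_gt0 : 0 < eps.
Implicit Types (s : cpre_state R n) (Y : set 'rV[R]_n).

Definition covered s : set 'rV[R]_n :=
  boxes_union (todo s) `|` boxes_union (inner s).

Definition potential s : nat :=
  (total_weight eps (todo s) + total_weight eps (inner s))%N.

Lemma cpre_step_todo Y s s' : cpre_step F eps Y s s' ->
  (total_weight eps (todo s') < total_weight eps (todo s))%N.
Proof.
case=> [L1 b L2 Xi Xd Xc _|L1 b L2 Xi Xd Xc _ _|L1 b L2 Xi Xd Xc _ _ _|
        L1 b L2 Xi Xd Xc i _ _ we wi] /=;
  rewrite total_weight_remove ?total_weight_cons;
  try by rewrite -add1n leq_add2r weight_gt0.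
by have := weight_bisect eps_gt0 we wi; lia.
Qed.

(** The only step that does not lower the potential is the move of a box to the
    inner list, which keeps the covered set; this is what links termination of
    the outer loop to its test Y = Yt. *)
Lemma cpre_step_potential Y s s' : cpre_step F eps Y s s' ->
  (potential s' < potential s)%N \/
  (potential s' = potential s /\ covered s' = covered s).
Proof.
rewrite /potential /covered.
case=> [L1 b L2 Xi Xd Xc _|L1 b L2 Xi Xd Xc _ _|L1 b L2 Xi Xd Xc _ _ _|
        L1 b L2 Xi Xd Xc i _ _ we wi] /=;
  rewrite total_weight_remove ?boxes_union_remove ?total_weight_cons.
- by left; have := weight_gt0 eps b; lia.
- by right; split; [lia | rewrite boxes_union_cons setUCA setUA].
- by left; have := weight_gt0 eps b; lia.
- by left; have := weight_bisect eps_gt0 we wi; lia.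
Qed.

Lemma cpre_step_progress Y s : todo s <> [::] ->
  exists s', cpre_step F eps Y s s'.
Proof.
case: s => [[//|b L] Xi Xd Xc] _.
have [miss|hit] := pselect (misses F Y b).
  by eexists; exact: (CPreOutside _ [::] L Xi Xd Xc miss).
have [into|ninto] := pselect (maps_into F Y b).
  by eexists; exact: (CPreInner _ [::] L Xi Xd Xc hit into).
have [small|large] := ltP (width b) eps.
  by eexists; exact: (CPreBoundary [::] L Xi Xd Xc hit ninto small).
have [i wi] := width_attained (lt_le_trans eps_gt0 large).
by eexists; exact: (CPreBisect [::] L Xi Xd Xc hit ninto large wi).
Qed.

Lemma test_same_terminates Y L : terminates F eps (Test Y Y L).
Proof.
apply: TerminatesStep; first by exists (Done Y); exact: AlgExit.
move=> c; move El: (Test Y Y L) => l step.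
case: step El => // [Y1 Yt L1 _ _|Y1 Yt L1 neq [eqY1 eqYt _]].
  exact: TerminatesDone.
by case: neq; rewrite -eqY1 -eqYt.
Qed.

(** Induction on the weight of the boxes to be processed. The disjunction says
    what is known on return: either the new list is lighter than [N], and the
    hypothesis applies, or its union is still [Y], and the algorithm exits. *)
Lemma loop_terminates Y N :
  (forall Y' L, (total_weight eps L < N)%N ->
     terminates F eps (Test Y' (boxes_union L) L)) ->
  forall s, (potential s < N)%N \/ (potential s = N /\ covered s = Y) ->
  terminates F eps (Loop Y s).
Proof.
move=> IH s; have [k] := ubnP (total_weight eps (todo s)).
elim: k s => // k IHk s sk pot; apply: TerminatesStep.
  have [s0|/(cpre_step_progress Y)[s' step]] := pselect (todo s = [::]).
    by case: s s0 {sk pot} => L Xi Xd Xc /= ->; eexists; exact: AlgReturn.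
  by exists (Loop Y s'); exact: AlgCPre.
move=> c; move El: (Loop Y s) => l step.
case: step El => // [Y1 s1 s' step [YY1 ss1]|Y1 Xi Xd Xc [<- ss1]]; subst.
- apply: IHk; first by have := cpre_step_todo step; lia.
  have [lt_pot|[-> ->]] := cpre_step_potential step; last by [].
  by left; case: pot => [|[]]; lia.
- move: pot; rewrite /potential /covered /= boxes_union_nil set0U.
  rewrite {1 2}/total_weight big_nil add0n => -[small|[_ ->]]; first exact: IH.
  exact: test_same_terminates.
Qed.

Lemma test_terminates Y L : terminates F eps (Test Y (boxes_union L) L).
Proof.
have [N] := ubnP (total_weight eps L); elim: N Y L => // N IHN Y L LN.
have [->|YL] := pselect (Y = boxes_union L); first exact: test_same_terminates.
apply: TerminatesStep; first by eexists; exact: AlgEnter.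
move=> c; move El: (Test Y (boxes_union L) L) => l step.
case: step El => // [Y1 Yt L1 -> [YYt <- _]|Y1 Yt L1 _ [_ <- <-]].
  exact: TerminatesDone.
apply: (@loop_terminates _ (total_weight eps L)).
  by move=> Y' L' L'L; apply: IHN; lia.
right; rewrite /potential /covered /= boxes_union_nil setU0; split=> //.
by rewrite [X in (_ + X)%N]/total_weight big_nil addn0.
Qed.

End Run.

(** * Invariants of a run *)

Section Correctness.
Context {R : realType} {n : nat} {M : finType}.
Variables (f : M -> 'rV[R]_n -> 'rV[R]_n) (F : M -> box R n -> box R n).
Variables (Omega A : set 'rV[R]_n) (rho1 eps r : R).
Hypothesis F_incl : forall p, inclusion_function (f p) (F p).
Hypothesis F_width : forall p b, box_set b `<=` Omega ->
  width (F p b) <= rho1 * width b.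
Hypothesis rho1_ge0 : 0 <= rho1.
Hypothesis r_ge0 : 0 <= r.
Hypothesis rho1_eps : rho1 * eps <= r.
Hypothesis A_robust : A `<=` Pre f (pontryagin_diff A (inf_ball r)).

(** The undisturbed image of [x] already lies in [Y]. *)
Lemma robust_hits (Y : set 'rV[R]_n) b x :
  A `<=` Y -> A x -> box_set b x -> ~ misses F Y b.
Proof.
move=> AY Ax bx miss; have [p Ap] := A_robust Ax.
have : (box_set (F p b) `&` Y) (f p x).
  split; first by apply: F_incl; exists x.
  by apply: AY; rewrite -[f p x]addr0; apply: Ap; rewrite /inf_ball /= normr0.
by rewrite miss.
Qed.

(** The enclosure [F p b] contains the image of [x] and has width at most
    rho1 * eps <= r, so every point of it is that image plus a disturbance
    that [A] tolerates. *)
Lemma robust_maps_into (Y : set 'rV[R]_n) b x :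
  A `<=` Y -> A x -> box_set b x -> box_set b `<=` Omega -> width b <= eps ->
  maps_into F Y b.
Proof.
move=> AY Ax bx bO beps; have [p Ap] := A_robust Ax.
exists p => y Fy; apply: AY; rewrite -[y](subrK (f p x)) addrC.
apply: Ap; rewrite /inf_ball /=.
apply: le_trans (box_diameter _ Fy) _; first by apply: F_incl; exists x.
apply: le_trans (F_width p bO) _; apply: le_trans rho1_eps.
exact: ler_wpM2l.
Qed.

Lemma maps_into_pre (Y : set 'rV[R]_n) b :
  maps_into F Y b -> box_set b `<=` Pre f Y.
Proof. by move=> [p FY] x bx; exists p; apply/FY/F_incl; exists x. Qed.

(** [A `<=` covered s] says that no point of [A] went to the boundary or outside
    boxes. [covered s `<=` Y] is what keeps the boxes inside [Omega], where the
    width bound on the enclosures is valid. *)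
Definition loop_invariant (Y : set 'rV[R]_n) (s : cpre_state R n) : Prop :=
  [/\ Y `<=` Omega, A `<=` Y, covered s `<=` Y, A `<=` covered s &
      boxes_union (inner s) `<=` Pre f Y].

Lemma cpre_step_invariant Y s s' :
  cpre_step F eps Y s s' -> loop_invariant Y s -> loop_invariant Y s'.
Proof.
move=> step [YO AY sY As sPre].
suff: [/\ covered s' `<=` covered s, A `<=` covered s' &
          boxes_union (inner s') `<=` Pre f Y].
  by move=> [s's As' s'Pre]; split => //; exact: subset_trans sY.
move: sY As sPre; rewrite /covered.
case: step => [L1 b L2 Xi Xd Xc miss|L1 b L2 Xi Xd Xc _ into|
    L1 b L2 Xi Xd Xc _ ninto small|L1 b L2 Xi Xd Xc i _ _ _ _] /=;
  rewrite boxes_union_remove ?boxes_union_cons => sY As sPre.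
- split=> // x; first by case; [left; right|right].
  move=> Ax; have [[bx|]|] := As x Ax; [|by left|by right].
  by have := robust_hits AY Ax bx miss.
- split=> [x|x /As|x [/(maps_into_pre into)|/sPre]] //; rewrite /setU /=; tauto.
- split=> // x; first by case; [left; right|right].
  move=> Ax; have [[bx|]|] := As x Ax; [|by left|by right].
  case: ninto; apply: robust_maps_into AY Ax bx _ (ltW small).
  by move=> y yb; apply/YO/sY; left; left.
- split=> // [x|x /As]; rewrite (box_set_halves b i) /setU /=; tauto.
Qed.

(** In a [Test] configuration the boxes of the list were mapped into the
    previous target [Y], except at the start, where [Y] is empty and nothing
    has been tested. The implication covers both: at the start its premise
    makes [Yt] empty. *)
Definition run_invariant (c : config R n) : Prop :=
  match c with
  | Test Y Yt L => [/\ Yt = boxes_union L, Yt `<=` Omega, A `<=` Yt &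
                       Y = Yt -> Yt `<=` Pre f Yt]
  | Loop Y s => loop_invariant Y s
  | Done Y => [/\ Y `<=` Omega, A `<=` Y & Y `<=` Pre f Y]
  end.

Lemma alg_step_invariant c c' :
  alg_step F eps c c' -> run_invariant c -> run_invariant c'.
Proof.
case=> [Y Yt L YYt|Y Yt L _|Y s s' step|Y Xi Xd Xc] /=.
- by move=> [_ YtO AYt /(_ YYt) YtPre]; rewrite YYt.
- move=> [YtL YtO AYt _].
  by split; rewrite /covered //= boxes_union_nil ?setU0 -?YtL.
- exact: cpre_step_invariant.
- rewrite /loop_invariant /covered /= boxes_union_nil set0U.
  move=> [YO AY XY AX XPre]; split=> // [|YX]; first exact: subset_trans YO.
  by rewrite YX in XPre.
Qed.

Lemma alg_output_invariant (L0 : seq (box R n)) Y :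
  boxes_union L0 = Omega -> A `<=` Omega ->
  alg_output F eps Omega L0 Y ->
  [/\ Y `<=` Omega, A `<=` Y & Y `<=` Pre f Y].
Proof.
move=> L0O AO run; change (run_invariant (Done Y)).
have: run_invariant (alg_init Omega L0) by split=> // <-.
rewrite /alg_output in run; elim: run => [c c'|//|c c' c'' _ IH1 _ IH2].
  exact: alg_step_invariant.
by move/IH1/IH2.
Qed.

End Correctness.

Theorem theorem3 (R : realType) (n : nat) (M : finType) (hM : (0 < #|M|)%N)
    (f : M -> 'rV[R]_n -> 'rV[R]_n) (hf : forall p : M, continuous (f p))
    (Omega : set 'rV[R]_n) (hOmega : compact Omega)
    (rho1 : R) (hrho1 : 0 < rho1)
    (hLip : forall (p : M) (x y : 'rV[R]_n), Omega x -> Omega y ->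
       `|f p x - f p y| <= rho1 * `|x - y|)
    (F : M -> box R n -> box R n)
    (hFincl : forall p : M, inclusion_function (f p) (F p))
    (hFconv : forall p : M, convergent (F p))
    (hFrho : forall (p : M) (b : box R n), box_set b `<=` Omega ->
       width (F p b) <= rho1 * width b)
    (eps : R) (heps : 0 < eps)
    (L0 : seq (box R n)) (hL0 : boxes_union L0 = Omega)
    (hL0disj : disjoint_interiors L0) :
  terminates F eps (alg_init Omega L0) /\
  (forall (r : R) (Y : set 'rV[R]_n),
     0 <= r -> rho1 * eps <= r -> alg_output F eps Omega L0 Y ->
     (Y = set0 ->
        ~ exists A : set 'rV[R]_n,
            [/\ robustly_controlled_invariant f r A, A !=set0 &
                A `<=` Omega]) /\
     (Y <> set0 ->
        controlled_invariant f Y /\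
        exists Ir I : set 'rV[R]_n,
          [/\ maximal_inside (robustly_controlled_invariant f r) Omega Ir,
              maximal_inside (controlled_invariant f) Omega I,
              Ir `<=` Y & Y `<=` I])).
Proof.
split; first by rewrite /alg_init -hL0; exact: test_terminates.
move=> r Y r0 rho1_eps run.
have [Ir Irmax] := maximal_robustly_controlled_invariant r hf hOmega.
have [[_ IrPre] IrO Irge] := Irmax.
have [YO IrY YPre] := alg_output_invariant hFincl hFrho (ltW hrho1) r0 rho1_eps IrPre
  hL0 IrO run.
split=> [Y0 [A [Arob [x Ax] AO]]|_].
  by have := IrY _ (Irge _ Arob AO _ Ax); rewrite Y0.
have Yinv := pre_controlled_invariant YPre.
have Imax := maximal_controlled_invariant f Omega; have [_ _ Ige] := Imax.
by split=> //; exists Ir; eexists; split; [|exact: Imax| |exact: Ige].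
Qed.
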